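(* For all $\Phi\cup\{\varphi\}\subseteq Fm(C)$ and $m\in\{3,4,5\}$: if $\Phi\vdash_m\varphi$, then $\Phi\Vdash_m\varphi$.
   Context: Language: $Fm(C)$ is the set of formulas built from propositional variables $V=\{x_0,x_1,\dots\}$, a set $C$ of propositional constants containing $\top,\bot$, connectives $\neg,\rightarrow,\vee,\wedge$, the identity connective $\equiv$, the necessity operator $\square$ and the universal propositional quantifier $\forall$ ($\forall x\varphi$ is a formula only if $x$ occurs free in $\varphi$). $\varphi[x:=\psi]$ is capture-avoiding substitution (bound variables renamed as needed); $\varphi=_\alpha\psi$ means $\varphi,\psi$ differ only in bound variables. The system $S3^\forall_\equiv$ has as axioms all formulas of the forms: (i) substitution-instances of propositional tautologies; (ii) $\square\varphi\rightarrow\varphi$; (iii) $\square(\varphi\rightarrow\psi)\rightarrow(\square\varphi\rightarrow\square\psi)$; (iv) $\square(\varphi\rightarrow\psi)\rightarrow\square(\square\varphi\rightarrow\square\psi)$; (v) $\varphi\equiv\psi$ whenever $\varphi=_\alpha\psi$; (vi) $(\varphi\equiv\psi)\rightarrow(\varphi\rightarrow\psi)$; (vii) $(\psi\equiv\psi')\rightarrow(\varphi[x:=\psi]\equiv\varphi[x:=\psi'])$ for $x$ free in $\varphi$; (viii) $\forall x(\varphi\equiv\psi)\rightarrow(\forall x\varphi\equiv\forall x\psi)$; (ix) $\forall x\varphi\rightarrow\varphi[x:=\psi]$; (x) $\forall x(\varphi\rightarrow\psi)\rightarrow(\forall x\varphi\rightarrow\forall x\psi)$; (xi) $\forall x(\varphi\rightarrow\psi)\rightarrow(\varphi\rightarrow\forall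 x\psi)$ if $x$ not free in $\varphi$; (xii) $\square\forall x\varphi\rightarrow\forall x\square\varphi$; (xiii) $\forall x\square\varphi\rightarrow\square\forall x\varphi$; the axiom set is closed under: if $\varphi$ is an axiom and $x$ is free in $\varphi$, then $\forall x\varphi$ is an axiom. Rules: Modus Ponens and Axiom Necessitation (from an axiom $\varphi$ infer $\square\varphi$). $S4^\forall_\equiv$ adds $\square\varphi\rightarrow\square\square\varphi$; $S5^\forall_\equiv$ further adds $\neg\square\varphi\rightarrow\square\neg\square\varphi$. $\Phi\vdash_m\varphi$ means $\varphi$ is derivable from $\Phi$ in $Sm^\forall_\equiv$. Semantics: a Boolean prealgebra is $(M,f_\bot,f_\top,f_\neg,f_\vee,f_\wedge,f_\rightarrow,\le)$ with $\le$ a preorder such that $a\approx b:\Leftrightarrow(a\le b$ and $b\le a)$ is a congruence and the quotient is a Boolean algebra with order induced by $\le$ and induced operations as bottom, top, complement, join, meet, implication. A propositional domain is $\mathcal{M}=(M,\mathit{TRUE},\mathit{NEC},f_\bot,f_\top,f_\square,f_\neg,f_\vee,f_\wedge,f_\rightarrow,f_\equiv,f_\forall,\varGamma)$ with $\mathit{NEC},\mathit{TRUE}\subseteq M$, operations of the obvious arities, $f_\forall\colon M^M\to M$, $\varGamma\colon C\to M$ with $\varGamma(\bot)=f_\bot,\varGamma(\top)=f_\top$. An assignment $\gamma\colon V\to M$ extends to $Fm(C)$ by $\gamma(c)=\varGamma(c)$, $\gamma(\square\varphi)=f_\square(\gamma(\varphi))$, $\gamma(\neg\varphi)=f_\neg(\gamma(\varphi))$,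 $\gamma(\varphi@\psi)=f_@(\gamma(\varphi),\gamma(\psi))$, $\gamma(\forall x\varphi)=f_\forall(m\mapsto\gamma_x^m(\varphi))$ ($\gamma_x^m$ is $\gamma$ modified to send $x$ to $m$). $t\colon M\to M$ is $(\varphi,x,\gamma)$-definable if $t(m)=\gamma_x^m(\varphi)$ for all $m$; definable if so for some $\varphi$, $x$ free in $\varphi$, $\gamma$. Put $a\le_\mathcal{M}b:\Leftrightarrow f_\rightarrow(a,b)\in\mathit{NEC}$ and $a\approx_\mathcal{M}b$ iff both directions. $\mathcal{M}$ is an $S3^\forall_\equiv$-model if: (1) if $\mathit{NEC}\neq\varnothing$, $\le_\mathcal{M}$ is a preorder and $(M,f_\bot,f_\top,f_\neg,f_\vee,f_\wedge,f_\rightarrow,\le_\mathcal{M})$ is a Boolean prealgebra; (2) $f_\bot\notin\mathit{TRUE}$, $f_\top\in\mathit{TRUE}$, $f_\rightarrow,f_\neg,f_\wedge,f_\vee$ behave classically w.r.t. $\mathit{TRUE}$, $f_\square(a)\in\mathit{TRUE}\Leftrightarrow a\in\mathit{NEC}$, $f_\equiv(a,b)\in\mathit{TRUE}\Leftrightarrow a=b$, and $f_\forall(t)\in\mathit{TRUE}$ whenever $t$ is definable with image in $\mathit{TRUE}$; (3) if $\mathit{NEC}\neq\varnothing$: $\mathit{NEC}\subseteq\mathit{TRUE}$, $\mathit{NEC}$ is upward closed under $\le_\mathcal{M}$ and closed under $f_\wedge$; (4) if $\mathit{NEC}\neq\varnothing$: $f_\top\le_\mathcal{M}f_\equiv(a,a)$;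 $f_\equiv(a,b)\le_\mathcal{M}f_\rightarrow(a,b)$; $f_\equiv(a,b)\le_\mathcal{M}f_\equiv(t(a),t(b))$ for definable $t$; $f_\square(a)\le_\mathcal{M}a$; $f_\square(f_\rightarrow(a,b))\le_\mathcal{M}f_\rightarrow(f_\square(a),f_\square(b))$; $f_\square(f_\rightarrow(a,b))\le_\mathcal{M}f_\square(f_\rightarrow(f_\square(a),f_\square(b)))$; $f_\forall(t)\le_\mathcal{M}f_\equiv(f_\forall(t_1),f_\forall(t_2))$ and $f_\forall(t)\le_\mathcal{M}f_\rightarrow(f_\forall(t_1),f_\forall(t_2))$ whenever $t_1,t_2$ are $(\varphi,x,\gamma)$-, $(\psi,x,\gamma)$-definable and $t(a)=f_\equiv(t_1(a),t_2(a))$, resp. $t(a)=f_\rightarrow(t_1(a),t_2(a))$; $f_\forall(t)\le_\mathcal{M}t(a)$ for definable $t$; $f_\forall(t)\le_\mathcal{M}f_\rightarrow(b,f_\forall(t'))$ whenever $t'$ is $(\psi,x,\gamma)$-definable, $b$ is the denotation of a sentence and $t(a)=f_\rightarrow(b,t'(a))$; $f_\square(f_\forall(t))\approx_\mathcal{M}f_\forall(a\mapsto f_\square(t(a)))$ for definable $t$; $f_\forall(t)\in\mathit{NEC}$ whenever $t$ is definable with image in $\mathit{NEC}$. The model is normal if $\mathit{NEC}\neq\varnothing$. A normal $S3^\forall_\equiv$-model is an $S4^\forall_\equiv$-model if $f_\square(a)\le_\mathcal{M}f_\square(f_\square(a))$ for all $a$, and an $S4^\forall_\equiv$-model is an $S5^\forall_\equiv$-model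 if $f_\neg(f_\square(a))\le_\mathcal{M}f_\square(f_\neg(f_\square(a)))$ for all $a$. $(\mathcal{M},\gamma)\vDash\varphi:\Leftrightarrow\gamma(\varphi)\in\mathit{TRUE}$. $\Phi\Vdash_m\varphi$ iff for every normal $Sm^\forall_\equiv$-model $\mathcal{M}$ and assignment $\gamma$, $(\mathcal{M},\gamma)\vDash\Phi$ implies $(\mathcal{M},\gamma)\vDash\varphi$.
   Formalization: In the model condition f_∀(t) ≤ f_→(b, f_∀(t')), ''denotation of a sentence'' is read as denotation of any formula under any assignment (so any b); with closed sentences only, the necessitation of axiom (xi) fails in an 8-element S5-model, so the claim would be false. *)

(* Defs.v *)
From HB Require Import structures.
From mathcomp Require Import all_boot all_order.

Set Implicit Arguments.
Unset Strict Implicit.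
Unset Printing Implicit Defensive.

Record constants := Constants {
  const_sort :> Type;
  cbot : const_sort;
  ctop : const_sort;
  _ : cbot <> ctop }.

(* The variable x_n is represented by n.  [expr] also contains the expressions
   [All x phi] with x not free in phi; the formulas are the expressions that
   satisfy [Fm] below. *)
Inductive expr (C : constants) : Type :=
| Var of nat
| Const of C
| Neg of expr C
| Imp of expr C & expr C
| Or of expr C & expr C
| And of expr C & expr C
| Id of expr C & expr C
| Box of expr C
| All of nat & expr C.

Arguments Var {C} _.
Arguments Const {C} _.

Definition Bot {C : constants} : expr C := Const (cbot C).
Definition Top {C : constants} : expr C := Const (ctop C).

Section Syntax.
Variable C : constants.
Implicit Types (phi psi : expr C) (x y : nat).

Fixpoint fv phi : seq nat :=
  match phi with
  | Var x => [:: x]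
  | Const _ => [::]
  | Neg p | Box p => fv p
  | Imp p q | Or p q | And p q | Id p q => fv p ++ fv q
  | All x p => [seq y <- fv p | y != x]
  end.

Fixpoint Fm phi : bool :=
  match phi with
  | Var _ | Const _ => true
  | Neg p | Box p => Fm p
  | Imp p q | Or p q | And p q | Id p q => Fm p && Fm q
  | All x p => (x \in fv p) && Fm p
  end.

Definition update (T : Type) (f : nat -> T) (x : nat) (a : T) : nat -> T :=
  fun y => if y == x then a else f y.

(* [binder s x phi] is the bound variable of the result of applying the
   simultaneous substitution s to [All x phi]: it is x itself unless x would
   capture a free variable of some s y, y free in [All x phi], and otherwise a
   variable larger than all of those. *)
Definition binder (s : nat -> expr C) x phi : nat :=
  let l := flatten [seq fv (s y) | y <- fv (All x phi)] in
  if x \in l then (foldr maxn 0 l).+1 else x.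

Fixpoint ssubst (s : nat -> expr C) phi : expr C :=
  match phi with
  | Var x => s x
  | Const c => Const c
  | Neg p => Neg (ssubst s p)
  | Imp p q => Imp (ssubst s p) (ssubst s q)
  | Or p q => Or (ssubst s p) (ssubst s q)
  | And p q => And (ssubst s p) (ssubst s q)
  | Id p q => Id (ssubst s p) (ssubst s q)
  | Box p => Box (ssubst s p)
  | All x p => let z := binder s x p in All z (ssubst (update s x (Var z)) p)
  end.

Definition subst phi x psi : expr C := ssubst (update Var x psi) phi.

Inductive alpha : expr C -> expr C -> Prop :=
| alpha_rename x y p : y \notin fv p -> alpha (All x p) (All y (subst p x (Var y)))
| alpha_refl p : alpha p p
| alpha_sym p q : alpha p q -> alpha q p
| alpha_trans p q r : alpha p q -> alpha q r -> alpha p r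
| alpha_Neg p p' : alpha p p' -> alpha (Neg p) (Neg p')
| alpha_Imp p p' q q' : alpha p p' -> alpha q q' -> alpha (Imp p q) (Imp p' q')
| alpha_Or p p' q q' : alpha p p' -> alpha q q' -> alpha (Or p q) (Or p' q')
| alpha_And p p' q q' : alpha p p' -> alpha q q' -> alpha (And p q) (And p' q')
| alpha_Id p p' q q' : alpha p p' -> alpha q q' -> alpha (Id p q) (Id p' q')
| alpha_Box p p' : alpha p p' -> alpha (Box p) (Box p')
| alpha_All x p p' : alpha p p' -> alpha (All x p) (All x p').

End Syntax.

Inductive pform : Type :=
| PVar of nat
| PBot
| PTop
| PNeg of pform
| PImp of pform & pform
| POr of pform & pform
| PAnd of pform & pform.

Fixpoint ptruth (v : nat -> bool) (p : pform) : bool :=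
  match p with
  | PVar x => v x
  | PBot => false
  | PTop => true
  | PNeg p => ~~ ptruth v p
  | PImp p q => ptruth v p ==> ptruth v q
  | POr p q => ptruth v p || ptruth v q
  | PAnd p q => ptruth v p && ptruth v q
  end.

Definition tautology (p : pform) : Prop := forall v, ptruth v p.

Fixpoint pinst (C : constants) (s : nat -> expr C) (p : pform) : expr C :=
  match p with
  | PVar x => s x
  | PBot => Bot
  | PTop => Top
  | PNeg p => Neg (pinst s p)
  | PImp p q => Imp (pinst s p) (pinst s q)
  | POr p q => Or (pinst s p) (pinst s q)
  | PAnd p q => And (pinst s p) (pinst s q)
  end.

Inductive system : Type := S3 | S4 | S5.

Section Deduction.
Variable C : constants.
Implicit Types (p q r : expr C) (x : nat).

(* That the instances are formulas is required in [axiom]; this forces, e.g.,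
   x to be free in both p and q in [ax_All_Id] and [ax_All_Imp], and in q in
   [ax_All_const]. *)
Inductive schema : system -> expr C -> Prop :=
| ax_taut m t s : tautology t -> schema m (pinst s t)
| ax_T m p : schema m (Imp (Box p) p)
| ax_K m p q : schema m (Imp (Box (Imp p q)) (Imp (Box p) (Box q)))
| ax_S3 m p q : schema m (Imp (Box (Imp p q)) (Box (Imp (Box p) (Box q))))
| ax_alpha m p q : alpha p q -> schema m (Id p q)
| ax_Id_Imp m p q : schema m (Imp (Id p q) (Imp p q))
| ax_Id_subst m p x q r : Fm p -> x \in fv p ->
    schema m (Imp (Id q r) (Id (subst p x q) (subst p x r)))
| ax_All_Id m x p q :
    schema m (Imp (All x (Id p q)) (Id (All x p) (All x q)))
| ax_All_inst m x p q : schema m (Imp (All x p) (subst p x q))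
| ax_All_Imp m x p q :
    schema m (Imp (All x (Imp p q)) (Imp (All x p) (All x q)))
| ax_All_const m x p q : x \notin fv p ->
    schema m (Imp (All x (Imp p q)) (Imp p (All x q)))
| ax_Box_All m x p : schema m (Imp (Box (All x p)) (All x (Box p)))
| ax_All_Box m x p : schema m (Imp (All x (Box p)) (Box (All x p)))
| ax_S4 m p : m <> S3 -> schema m (Imp (Box p) (Box (Box p)))
| ax_S5 p : schema S5 (Imp (Neg (Box p)) (Box (Neg (Box p)))).

Inductive axiom (m : system) : expr C -> Prop :=
| axiom_schema p : schema m p -> Fm p -> axiom m p
| axiom_gen x p : axiom m p -> x \in fv p -> axiom m (All x p).

Inductive derives (m : system) (Phi : expr C -> Prop) : expr C -> Prop :=
| derives_premise p : Phi p -> derives m Phi p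
| derives_axiom p : axiom m p -> derives m Phi p
| derives_MP p q : derives m Phi p -> derives m Phi (Imp p q) -> derives m Phi q
| derives_AN p : axiom m p -> derives m Phi (Box p).

End Deduction.

Section Prealgebra.
Variables (M : Type) (fbot ftop : M) (fneg : M -> M).
Variables (for_ fand fimp : M -> M -> M) (le : M -> M -> Prop).

Definition equiv_of (a b : M) : Prop := le a b /\ le b a.

Definition preorder : Prop :=
  (forall a, le a a) /\ (forall a b c, le a b -> le b c -> le a c).

Definition congruence2 (f : M -> M -> M) : Prop :=
  forall a a' b b', equiv_of a a' -> equiv_of b b' -> equiv_of (f a b) (f a' b').

(* The Boolean algebra B, with projection pi, is the quotient of M by
   [equiv_of] with the induced order and the induced operations. *)
Record boolean_quotient (d : Order.disp_t) (B : ctbDistrLatticeType d)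
    (pi : M -> B) : Prop := BooleanQuotient {
  pi_surj : forall u, exists a, pi a = u;
  pi_eq : forall a b, pi a = pi b <-> equiv_of a b;
  pi_le : forall a b, (pi a <= pi b)%O <-> le a b;
  pi_bot : pi fbot = \bot%O;
  pi_top : pi ftop = \top%O;
  pi_neg : forall a, pi (fneg a) = (~` pi a)%O;
  pi_or : forall a b, pi (for_ a b) = (pi a `|` pi b)%O;
  pi_and : forall a b, pi (fand a b) = (pi a `&` pi b)%O;
  pi_imp : forall a b, pi (fimp a b) = (~` pi a `|` pi b)%O }.

Record boolean_prealgebra : Prop := BooleanPrealgebra {
  prealgebra_preorder : preorder;
  prealgebra_neg : forall a a', equiv_of a a' -> equiv_of (fneg a) (fneg a');
  prealgebra_or : congruence2 for_;
  prealgebra_and : congruence2 fand;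
  prealgebra_imp : congruence2 fimp;
  prealgebra_quotient : exists (d : Order.disp_t) (B : ctbDistrLatticeType d)
    (pi : M -> B), boolean_quotient pi }.

End Prealgebra.

Record domain (C : constants) := Domain {
  carrier :> Type;
  TRUE : carrier -> Prop;
  NEC : carrier -> Prop;
  fbot : carrier;
  ftop : carrier;
  fbox : carrier -> carrier;
  fneg : carrier -> carrier;
  for_ : carrier -> carrier -> carrier;
  fand : carrier -> carrier -> carrier;
  fimp : carrier -> carrier -> carrier;
  fid : carrier -> carrier -> carrier;
  fall : (carrier -> carrier) -> carrier;
  Gam : C -> carrier;
  Gam_bot : Gam (cbot C) = fbot;
  Gam_top : Gam (ctop C) = ftop }.

Arguments fbot {C} _.
Arguments ftop {C} _.

Section Models.
Variables (C : constants) (M : domain C).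
Implicit Types (a b : M) (t : M -> M) (g : nat -> M) (p q : expr C).

Fixpoint eval g p : M :=
  match p with
  | Var x => g x
  | Const c => Gam M c
  | Neg p => fneg (eval g p)
  | Imp p q => fimp (eval g p) (eval g q)
  | Or p q => for_ (eval g p) (eval g q)
  | And p q => fand (eval g p) (eval g q)
  | Id p q => fid (eval g p) (eval g q)
  | Box p => fbox (eval g p)
  | All x p => fall (fun a => eval (update g x a) p)
  end.

Definition definable_by p x g t : Prop :=
  Fm p /\ forall a, t a = eval (update g x a) p.

Definition definable t : Prop :=
  exists p x g, x \in fv p /\ definable_by p x g t.

(* "b is the denotation of a sentence".  Here a sentence is a formula, possibly
   with free variables, interpreted under some assignment.  If only closed
   formulas were allowed, the necessitation of the axiom [ax_All_const], whose
   antecedent p may have free variables, would not be valid: let M be the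
   powerset of {1,2,3} with TRUE = {a | 1 \in a}, NEC = {{1,2,3}}, the set
   operations, fbox a and fid a b the full set or the empty set according to
   whether a \in NEC and a = b, and let i \in fall t iff every t a contains the
   block of i in the partition {{1},{2,3}}.  All closed formulas denote unions
   of blocks, all other conditions below hold, and
   Box (All x (y -> q) -> (y -> All x q)) with q := y /\ (x \/ ~ x) is false
   when y denotes {2}. *)
Definition denotation b : Prop := exists p g, Fm p /\ b = eval g p.

Definition leM a b : Prop := NEC (fimp a b).
Definition approxM : M -> M -> Prop := equiv_of leM.

Definition normal : Prop := exists a, NEC a.

Record true_conditions : Prop := TrueConditions {
  true_bot : ~ TRUE (fbot M);
  true_top : TRUE (ftop M);
  true_imp : forall a b, TRUE (fimp a b) <-> (TRUE a -> TRUE b);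
  true_neg : forall a, TRUE (fneg a) <-> ~ TRUE a;
  true_and : forall a b, TRUE (fand a b) <-> TRUE a /\ TRUE b;
  true_or : forall a b, TRUE (for_ a b) <-> TRUE a \/ TRUE b;
  true_box : forall a, TRUE (fbox a) <-> NEC a;
  true_id : forall a b, TRUE (fid a b) <-> a = b;
  true_all : forall t, definable t -> (forall a, TRUE (t a)) -> TRUE (fall t) }.

Record nec_conditions : Prop := NecConditions {
  nec_true : forall a, NEC a -> TRUE a;
  nec_up : forall a b, NEC a -> leM a b -> NEC b;
  nec_and : forall a b, NEC a -> NEC b -> NEC (fand a b) }.

Record order_conditions : Prop := OrderConditions {
  le_id_refl : forall a, leM (ftop M) (fid a a);
  le_id_imp : forall a b, leM (fid a b) (fimp a b);
  le_id_def : forall t a b, definable t -> leM (fid a b) (fid (t a) (t b));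
  le_box : forall a, leM (fbox a) a;
  le_box_K : forall a b, leM (fbox (fimp a b)) (fimp (fbox a) (fbox b));
  le_box_S3 : forall a b,
    leM (fbox (fimp a b)) (fbox (fimp (fbox a) (fbox b)));
  le_all_id : forall p q x g t1 t2 t,
    definable_by p x g t1 -> definable_by q x g t2 ->
    (forall a, t a = fid (t1 a) (t2 a)) ->
    leM (fall t) (fid (fall t1) (fall t2));
  le_all_imp : forall p q x g t1 t2 t,
    definable_by p x g t1 -> definable_by q x g t2 ->
    (forall a, t a = fimp (t1 a) (t2 a)) ->
    leM (fall t) (fimp (fall t1) (fall t2));
  le_all_inst : forall t a, definable t -> leM (fall t) (t a);
  le_all_const : forall q x g t' t b,
    definable_by q x g t' -> denotation b ->
    (forall a, t a = fimp b (t' a)) ->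
    leM (fall t) (fimp b (fall t'));
  box_all : forall t, definable t ->
    approxM (fbox (fall t)) (fall (fun a => fbox (t a)));
  nec_all : forall t, definable t -> (forall a, NEC (t a)) -> NEC (fall t) }.

Record S3_model : Prop := S3Model {
  S3_prealgebra : normal ->
    boolean_prealgebra (fbot M) (ftop M) (@fneg C M) (@for_ C M) (@fand C M)
      (@fimp C M) leM;
  S3_true : true_conditions;
  S3_nec : normal -> nec_conditions;
  S3_order : normal -> order_conditions }.

Definition S4_model : Prop :=
  [/\ S3_model, normal & forall a, leM (fbox a) (fbox (fbox a))].

Definition S5_model : Prop :=
  S4_model /\ forall a, leM (fneg (fbox a)) (fbox (fneg (fbox a))).

Definition model (m : system) : Prop :=
  match m with S3 => S3_model | S4 => S4_model | S5 => S5_model end.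

Definition sat g p : Prop := TRUE (eval g p).

End Models.

Definition entails (C : constants) (m : system) (Phi : expr C -> Prop)
    (phi : expr C) : Prop :=
  forall M : domain C, model M m -> normal M ->
  forall g : nat -> M, (forall psi, Phi psi -> sat g psi) -> sat g phi.

(* Main.v *)
(** Every axiom denotes a necessary proposition in every normal model, under
    every assignment; this is stronger than truth, so it also covers Axiom
    Necessitation, and it survives generalization because [NEC] is closed under
    [fall] of definable functions.  For tautologies it holds because a
    propositional tautology evaluates to the top of any Boolean algebra; for the
    axioms with substitution or renaming, one needs the substitution lemma
    (evaluating [ssubst s p] under [g] is evaluating [p] under [eval g \o s]);
    the remaining schemas are conditions on the model. *)
Require Import Defs.
From mathcomp Require Import all_boot all_order.
From Stdlib Require Import FunctionalExtensionality.
Import Order.Theory.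

Set Implicit Arguments.
Unset Strict Implicit.
Unset Printing Implicit Defensive.

Section BooleanTautologies.
Context {d : Order.disp_t} {B : ctbDistrLatticeType d}.
Local Open Scope order_scope.
Implicit Types (b : nat -> B) (v : nat -> bool) (c u : B) (t : pform).

Definition literal (e : bool) (c : B) : B := if e then c else ~` c.

Fixpoint peval b t : B :=
  match t with
  | PVar x => b x
  | PBot => \bot
  | PTop => \top
  | PNeg p => ~` peval b p
  | PImp p q => ~` peval b p `|` peval b q
  | POr p q => peval b p `|` peval b q
  | PAnd p q => peval b p `&` peval b q
  end.

Fixpoint var_bound t : nat :=
  match t with
  | PVar x => x.+1
  | PBot | PTop => 0%N
  | PNeg p => var_bound p
  | PImp p q | POr p q | PAnd p q => maxn (var_bound p) (var_bound q)
  end.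

(* Below [c] the value of each variable under [b] is decided by [v], hence so is
   the value of [t]. *)
Lemma le_literal_peval b v c t :
    (forall i, (i < var_bound t)%N -> c <= literal (v i) (b i)) ->
  c <= literal (ptruth v t) (peval b t).
Proof.
have split2 m n (P : nat -> Prop) : (forall i, (i < maxn m n)%N -> P i) ->
    (forall i, (i < m)%N -> P i) /\ (forall i, (i < n)%N -> P i).
  by move=> H; split=> i lt_i; apply: H; rewrite leq_max lt_i ?orbT.
elim: t => [x|||p IHp|p IHp q IHq|p IHp q IHq|p IHp q IHq] /=.
- by apply.
- by rewrite /literal compl0 lex1.
- by rewrite /literal lex1.
- by move/IHp; rewrite /literal; case: (ptruth v p) => //=; rewrite complK.
(* De Morgan turns each complemented compound into a meet or a join; below a meet both bounds are
   needed, below a join one is enough. *)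
- case/split2 => /IHp {}IHp /IHq {}IHq; move: IHp IHq; rewrite /literal.
  case: (ptruth v p); case: (ptruth v q) => /= lep leq;
  by rewrite ?complU ?complK ?lexI ?lep ?leq // lexU2 ?lep ?leq ?orbT.
- case/split2 => /IHp {}IHp /IHq {}IHq; move: IHp IHq; rewrite /literal.
  case: (ptruth v p); case: (ptruth v q) => /= lep leq;
  by rewrite ?complU ?lexI ?lep ?leq // lexU2 ?lep ?leq ?orbT.
- case/split2 => /IHp {}IHp /IHq {}IHq; move: IHp IHq; rewrite /literal.
  case: (ptruth v p); case: (ptruth v q) => /= lep leq;
  by rewrite ?complI ?lexI ?lep ?leq // lexU2 ?lep ?leq ?orbT.
Qed.

(** Case analysis inside a Boolean algebra: [c] is a finite join of pieces, each lying below [b i]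
    or its complement for every [i < n], so it suffices to bound the pieces. *)
Lemma le_by_literals b n c u :
    (forall c' v, c' <= c -> (forall i, (i < n)%N -> c' <= literal (v i) (b i)) ->
       c' <= u) ->
  c <= u.
Proof.
elim: n => [|n IHn] H; first exact: (H c xpredT).
apply: IHn => c' v lec' Hv.
(* [c'] is already decided on [b i] for [i < n]; meeting it with a literal of [b n] decides one more
   index, recorded by changing [v] at [n]. *)
have half e : c' `&` literal e (b n) <= u.
  apply: (H _ (update v n e)) => [|i]; first by rewrite (le_trans (leIl _ _)).
  rewrite ltnS leq_eqVlt /update; case: eqVneq => [-> _|_ /= lt_in].
    exact: leIr.
  by rewrite (le_trans (leIl _ _)) ?Hv.
have -> : c' = (c' `&` b n) `|` (c' `&` ~` b n).
  by rewrite -meetUr joinxC meetx1.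
by rewrite leUx (half true) (half false).
Qed.

(** Split [\top] along the variables of [t]: each piece follows some valuation, which makes [t]
    true, so the piece lies below [peval b t]. *)
Lemma peval_tautology b t : tautology t -> peval b t = \top.
Proof.
move=> taut; apply/eqP; rewrite -le1x.
apply: (@le_by_literals b (var_bound t)) => c v _ /le_literal_peval.
by rewrite taut.
Qed.

End BooleanTautologies.

Section Evaluation.
Context {C : constants} {M : domain C}.
Implicit Types (g : nat -> M) (p q : expr C) (s : nat -> expr C).

(** As [fall] takes a function as argument, the quantifier case rests on functional
    extensionality. *)
Lemma eq_eval_fv g g' p : {in fv p, g =1 g'} -> eval g p = eval g' p.
Proof.
elim: p g g' => [x|c|p IHp|p IHp q IHq|p IHp q IHq|p IHp q IHq|p IHp q IHq
  |p IHp|x p IHp] g g' eqg //=.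
- by apply: eqg; rewrite inE.
- by rewrite (IHp g g').
- by rewrite (IHp g g') ?(IHq g g') // => y yp; apply: eqg;
    rewrite mem_cat yp ?orbT.
- by rewrite (IHp g g') ?(IHq g g') // => y yp; apply: eqg;
    rewrite mem_cat yp ?orbT.
- by rewrite (IHp g g') ?(IHq g g') // => y yp; apply: eqg;
    rewrite mem_cat yp ?orbT.
- by rewrite (IHp g g') ?(IHq g g') // => y yp; apply: eqg;
    rewrite mem_cat yp ?orbT.
- by rewrite (IHp g g').
- congr fall; apply: functional_extensionality => a; apply: IHp => y yp.
  by rewrite /update; case: eqVneq => // neq_yx; apply: eqg;
    rewrite mem_filter neq_yx.
Qed.

Lemma eval_update_notin g x a p : x \notin fv p -> eval (update g x a) p = eval g p.
Proof.
move=> xNp; apply: eq_eval_fv => y yp; rewrite /update.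
by case: eqVneq yp xNp => // -> ->.
Qed.

Lemma binder_notin s x p y :
  y \in fv p -> y != x -> binder s x p \notin fv (s y).
Proof.
move=> yp neq_yx; rewrite /binder; set l := flatten _.
have sub z : z \in fv (s y) -> z \in l.
  move=> zs; apply/flattenP; exists (fv (s y)) => //.
  by apply: map_f; rewrite mem_filter neq_yx.
have le_max z (r : seq nat) : z \in r -> z <= foldr maxn 0 r.
  elim: r => //= w r IHr; rewrite inE leq_max => /predU1P[->|/IHr ->].
    by rewrite leqnn.
  by rewrite orbT.
case: ifPn => [_|xNl]; last exact: contra (sub x) xNl.
by apply/negP => /sub/le_max; rewrite ltnn.
Qed.

Lemma eval_ssubst g s p : eval g (ssubst s p) = eval (fun y => eval g (s y)) p.
Proof.
elim: p g s => [x|c|p IHp|p IHp q IHq|p IHp q IHq|p IHp q IHq|p IHp q IHq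
  |p IHp|x p IHp] g s /=; rewrite ?IHp ?IHq //.
congr fall; apply: functional_extensionality => a.
rewrite IHp; apply: eq_eval_fv => y yp; rewrite /update.
(* The new binder takes over the value [a] of [x]; it is not free in [s y] for the other [y], so
   there the update is invisible. *)
case: (eqVneq y x) => [_|neq_yx] /=; first by rewrite eqxx.
by apply: (@eval_update_notin g); apply: binder_notin.
Qed.

Lemma eval_subst g p x q : eval g (subst p x q) = eval (update g x (eval g q)) p.
Proof.
rewrite /subst eval_ssubst; apply: eq_eval_fv => y _.
by rewrite /update; case: eqP.
Qed.

(** Equality, not just [approxM], is what [ax_alpha] needs, since [fid a b] is true only when
    [a = b]. *)
Lemma eval_alpha g p q : alpha p q -> eval g p = eval g q.
Proof.
move=> apq; elim: apq g => {p q} //=.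
- move=> x y p yNp g; congr fall; apply: functional_extensionality => a.
  rewrite eval_subst; apply: eq_eval_fv => z zp.
  rewrite /update; case: (z == x) => /=; first by rewrite eqxx.
  by case: eqVneq zp yNp => // -> ->.
- by move=> p q r _ IHp _ IHq g; rewrite IHp.
- by move=> p p' _ IHp g; rewrite IHp.
- by move=> p p' q q' _ IHp _ IHq g; rewrite IHp IHq.
- by move=> p p' q q' _ IHp _ IHq g; rewrite IHp IHq.
- by move=> p p' q q' _ IHp _ IHq g; rewrite IHp IHq.
- by move=> p p' q q' _ IHp _ IHq g; rewrite IHp IHq.
- by move=> p p' _ IHp g; rewrite IHp.
- by move=> x p p' _ IHp g; congr fall; apply: functional_extensionality.
Qed.

End Evaluation.

Lemma model_S3 (C : constants) (M : domain C) m : model M m -> S3_model M.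
Proof. by case: m => //= [[]|[[]]]. Qed.

Lemma Fm_axiom (C : constants) m (p : expr C) : axiom m p -> Fm p.
Proof. by elim=> //= x q _ Fq ->. Qed.

Section Soundness.
Context {C : constants} {M : domain C} {m : system}.
Hypotheses (M_model : model M m) (M_normal : normal M).
Implicit Types (g : nat -> M) (p : expr C).

Let M_nec : nec_conditions M := S3_nec (model_S3 M_model) M_normal.
Let M_order : order_conditions M := S3_order (model_S3 M_model) M_normal.

Lemma nec_of_le_top a : leM (ftop M) a -> NEC a.
Proof.
(* [ftop] is itself necessary: by normality some [e] is, and [e] lies below [ftop] in the Boolean
   quotient. *)
apply: nec_up => //; case: M_normal => e nec_e; apply: nec_up nec_e _ => //.
have [d [B [pi Q]]] :=
  prealgebra_quotient (S3_prealgebra (model_S3 M_model) M_normal).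
by apply/(pi_le Q); rewrite (pi_top Q) lex1.
Qed.

Lemma nec_tautology g t s : tautology t -> NEC (eval g (pinst s t)).
Proof.
move=> taut; apply: nec_of_le_top.
have [d [B [pi Q]]] :=
  prealgebra_quotient (S3_prealgebra (model_S3 M_model) M_normal).
apply/(pi_le Q).
(* [pi] is a homomorphism, so the instance is sent to the value of [t] in the quotient algebra. *)
suff -> : pi (eval g (pinst s t)) = peval (fun x => pi (eval g (s x))) t.
  by rewrite peval_tautology // lex1.
elim: t {taut} => //= [||p IHp|p IHp q IHq|p IHp q IHq|p IHp q IHq].
- by rewrite Gam_bot (pi_bot Q).
- by rewrite Gam_top (pi_top Q).
- by rewrite (pi_neg Q) IHp.
- by rewrite (pi_imp Q) IHp IHq.
- by rewrite (pi_or Q) IHp IHq.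
- by rewrite (pi_and Q) IHp IHq.
Qed.

Lemma definable_eval g x p :
  x \in fv p -> Fm p -> definable (fun a => eval (update g x a) p).
Proof. by move=> xp Fp; exists p, x, g. Qed.

Lemma nec_schema g p : schema m p -> Fm p -> NEC (eval g p).
Proof.
(* [M_model] joins the case analysis so that the last two schemas see the condition of their own
   system. The implications close by conversion, [NEC (fimp a b)] being [leM a b]. *)
move=> sp; case: m p / sp M_model.
- by move=> m' t s taut _ _; apply: nec_tautology.
- by move=> m' p _ _; apply: le_box.
- by move=> m' p q _ _; apply: le_box_K.
- by move=> m' p q _ _; apply: le_box_S3.
- move=> m' p q apq _ _; apply: nec_of_le_top => /=.
  by rewrite (eval_alpha g apq); apply: le_id_refl.
- by move=> m' p q _ _; apply: le_id_imp.
- move=> m' p x q r Fp xp _ _ /=; rewrite !eval_subst.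
  exact: (le_id_def M_order _ _ (definable_eval g xp Fp)).
- move=> m' x p q _ /=; case/andP=> /andP[_ /andP[Fp Fq]] _.
  by apply: (@le_all_id _ _ M_order p q x g).
- move=> m' x p q _ /= /andP[/andP[xp Fp] _]; rewrite eval_subst.
  exact: (le_all_inst M_order _ (definable_eval g xp Fp)).
- move=> m' x p q _ /=; case/andP=> /andP[_ /andP[Fp Fq]] _.
  by apply: (@le_all_imp _ _ M_order p q x g).
- move=> m' x p q xNp _ /=; case/andP=> /andP[_ /andP[Fp Fq]] _.
  apply: (@le_all_const _ _ M_order q x g) => [//||a].
    (* [p] may have free variables; [g] interprets them. *)
    by exists p, g.
  by rewrite eval_update_notin.
- move=> m' x p _ /=; case/andP=> /andP[xp Fp] _.
  by case: (box_all M_order (definable_eval g xp Fp)).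
- move=> m' x p _ /=; case/andP=> /andP[xp Fp] _.
  by case: (box_all M_order (definable_eval g xp Fp)).
- move=> m' p neq_m'; case: m' neq_m' => //= _ [].
    by move=> _ _ le4 _; apply: le4.
  by case=> _ _ le4 _ _; apply: le4.
- by move=> p [_ le5] _; apply: le5.
Qed.

Lemma nec_axiom g p : axiom m p -> NEC (eval g p).
Proof.
move=> ax; elim: ax g => {p} [p sp Fp|x p ax IHp xp] g.
  exact: nec_schema.
(* The induction hypothesis holds for all assignments, in particular for each [update g x a]. *)
apply: (nec_all M_order) => [|a]; last exact: IHp.
exact: definable_eval xp (Fm_axiom ax).
Qed.

End Soundness.

Theorem theorem15 (C : constants) (m : system) (Phi : expr C -> Prop)
    (phi : expr C) (hPhi : forall psi, Phi psi -> Fm psi) (hphi : Fm phi) :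
  derives m Phi phi -> entails m Phi phi.
Proof.
move=> der M mM nM g satPhi; have S3M := model_S3 mM.
elim: der => {phi hphi} [p /satPhi //|p ax|p q _ sp _ spq|p ax].
- exact: nec_true (S3_nec S3M nM) _ (nec_axiom mM nM g ax).
- by move/(true_imp (S3_true S3M)): spq; apply.
- by apply/(true_box (S3_true S3M)); apply: nec_axiom ax.
Qed.
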